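(* Let $\lambda,\lambda_s,\mu>0$ with $\lambda+\lambda_s<\mu$. For each $N$, let $\Pi_N$ be the stationary distribution of the Markov process $\{U^N(t),t\ge0\}$ of the finite $N$ model, and let $\pi=(\pi_0,\pi_1,\ldots)$ be given by $\pi_0=1-\rho$, $\pi_k=\rho(1-\sigma)\sigma^{k-1}$ for $k\ge1$, where $\rho=(\lambda+\lambda_s)/\mu$ and $\sigma=\lambda/\mu$. Then $$\lim_{N\to\infty}\Pi_N=\delta_\pi$$ in the sense of weak convergence, where $\delta_\pi$ is the point mass at $\pi$; equivalently, the stationary state $\pi^N=u^N(\infty)$ of the finite $N$ model (a random vector with law $\Pi_N$) converges to $\pi$ in distribution as $N\to\infty$.
   Context: Finite $N$ model: $N$ parallel queues, each with infinite waiting space and one server with exponential service rate $\mu$. Each queue has its own dedicated Poisson arrival stream of rate $\lambda$; an additional Poisson stream of rate $N\lambda_s$ brings customers who each join a shortest queue. All streams and services are independent. $X_i^N(t)$ is the length of queue $i$ at time $t$, and $U^N_k(t)=\frac1N\#\{i: X^N_i(t)=k\}$, $k\ge0$. Then $U^N(t)=(U^N_0(t),U^N_1(t),\ldots)$ is a continuous-time Markov process on the vectors $u=(u_0,u_1,\ldots)$ with $0\le u_k\le1$, $Nu_k$ a nonnegative integer for all $k$, and $\sum_{k\ge0}u_k=1$. These vectors are regarded as elements of $[0,1]^{\{0,1,2,\ldots\}}$ with componentwise convergence. *)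

(* Defs.v *)
From HB Require Import structures.
From mathcomp Require Import all_boot all_order all_algebra.
From mathcomp Require Import all_classical all_reals all_analysis.

Set Implicit Arguments.
Unset Strict Implicit.
Unset Printing Implicit Defensive.
Import Order.TTheory GRing.Theory Num.Theory.
Import numFieldNormedType.Exports.
Local Open Scope classical_set_scope.
Local Open Scope ring_scope.

Definition borel (T : ptopologicalType) := g_sigma_algebraType (@open T).

(* Weak convergence of measures on the subspace E of T: they are given as Borel
   measures on T carried by E, and tested against the bounded continuous real
   functions on E. *)
Definition weak_cvg_on (R : realType) (T : ptopologicalType) (E : set T)
    (mu_ : nat -> {measure set (borel T) -> \bar R})
    (mu : {measure set (borel T) -> \bar R}) : Prop :=
  forall f : T -> R,
    {within E, continuous f} ->
    (exists M : R, forall x, E x -> `|f x| <= M) ->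
    (\int[mu_ n]_(x in (E : set (borel T))) (f x)%:E)%E @[n --> \oo] -->
    (\int[mu]_(x in (E : set (borel T))) (f x)%:E)%E.

(* Real sequences, with the topology of componentwise convergence. *)
Definition seqspace (R : realType) : Type := {ptws nat -> R}.
HB.instance Definition _ (R : realType) := Topological.on (seqspace R).
HB.instance Definition _ (R : realType) := Pointed.on (seqspace R).

Definition cube (R : realType) : set (seqspace R) :=
  [set u | forall k : nat, 0 <= u k <= 1].
Arguments cube R : clear implicits.

Notation config N := {ffun 'I_N -> nat}.

Definition enter (N : nat) (x : config N) (i : 'I_N) : config N :=
  [ffun j => (x j + (j == i))%N].

Definition leave (N : nat) (x : config N) (i : 'I_N) : config N :=
  [ffun j => (x j - (j == i))%N].

Definition shortest (N : nat) (x : config N) (i : 'I_N) : bool :=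
  [forall j : 'I_N, (x i <= x j)%N].

(* tie x i is the probability that a customer of the shared stream who finds
   the queue lengths x joins queue i. *)
Definition tie_rule (R : realType) (N : nat) (tie : config N -> 'I_N -> R)
    : Prop :=
  forall x : config N,
    [/\ forall i, 0 <= tie x i,
        forall i, ~~ shortest x i -> tie x i = 0 &
        \sum_(i < N) tie x i = 1].

(* Q-matrix of the Markov process of queue lengths. Each possible jump x -> x'
   of rate r contributes r at (x, x') and - r at (x, x). *)
Definition qrate (R : realType) (lambda lambda_s mu : R) (N : nat)
    (tie : config N -> 'I_N -> R) (x y : config N) : R :=
  \sum_(i < N) (lambda + N%:R * lambda_s * tie x i)
                 * ((y == enter x i)%:R - (y == x)%:R)
  + \sum_(i < N) mu * (0 < x i)%N%:R
                 * ((y == leave x i)%:R - (y == x)%:R).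

(* P t x y, t >= 0, is a Markov transition function on S with Q-matrix q, that
   is P h x y = (x == y) + q x y * h + o(h) as h -> 0+. When q is bounded, as
   is the case of qrate, there is exactly one such P. *)
Definition transition_function (R : realType) (S : choiceType)
    (q : S -> S -> R) (P : R -> S -> S -> R) : Prop :=
  [/\ forall (t : R) x y, 0 <= t -> 0 <= P t x y,
      forall (t : R) x, 0 <= t -> \esum_(y in [set: S]) (P t x y)%:E = 1%E,
      forall x y, P 0 x y = (x == y)%:R,
      forall (s t : R) x z, 0 <= s -> 0 <= t ->
        (P (s + t) x z)%:E = \esum_(y in [set: S]) (P s x y * P t y z)%:E &
      forall x y, (P h x y - (x == y)%:R) / h @[h --> 0^'+] --> q x y].

Definition prob_mass (R : realType) (S : choiceType) (nu : S -> R) : Prop :=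
  (forall x, 0 <= nu x) /\ \esum_(x in [set: S]) (nu x)%:E = 1%E.

(* Law at time t of the process started with law nu. *)
Definition law_at (R : realType) (S : choiceType) (P : R -> S -> S -> R)
    (nu : S -> R) (t : R) (y : S) : \bar R :=
  \esum_(x in [set: S]) (nu x * P t x y)%:E.

(* u_k is the proportion of queues of length k. *)
Definition occupancy (R : realType) (N : nat) (x : config N) : seqspace R :=
  fun k : nat => #|[pred i : 'I_N | x i == k]|%:R / N%:R.

Definition occupancy_law (R : realType) (N : nat) (p : config N -> \bar R)
    (A : set (seqspace R)) : \bar R :=
  \esum_(x in [set x | A (occupancy R x)]) p x.

(* Pi is a stationary distribution of the process U(t) = occupancy (X(t)),
   where X has transition function P: U(0) having law Pi, U(t) has law Pi for
   all t. The process U is Markov, so that the law of U(t) depends on the law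
   nu of X(0) only through the law of U(0). *)
Definition stationary_occupancy (R : realType) (N : nat)
    (P : R -> config N -> config N -> R)
    (Pi : probability (borel (seqspace R)) R) : Prop :=
  exists nu : config N -> R,
    [/\ prob_mass nu,
        forall A : set (borel (seqspace R)), measurable A ->
          Pi A = occupancy_law (fun x => (nu x)%:E) A &
        forall (t : R) (A : set (borel (seqspace R))), 0 <= t -> measurable A ->
          occupancy_law (law_at P nu t) A = Pi A].

Definition limit_profile (R : realType) (lambda lambda_s mu : R) : seqspace R :=
  let rho := (lambda + lambda_s) / mu in
  let sigma := lambda / mu in
  fun k : nat => if k is j.+1 then rho * (1 - sigma) * sigma ^+ j else 1 - rho.

(* Main.v *)
Require Import Defs.
From mathcomp Require Import all_boot all_order all_algebra finmap.
From mathcomp Require Import all_classical all_reals all_analysis measurable_realfun.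
From mathcomp Require Import ring lra.
Import Order.TTheory GRing.Theory Num.Theory.
Import numFieldNormedType.Exports.
Local Open Scope classical_set_scope.
Local Open Scope ring_scope.

(** The proof is a single Lyapunov estimate, carried out under the stationary
    law. Let s_k be the proportion of queues of length at least k, s*_k its
    value under the limit profile, and d_k = s_k - s*_k, so that d_0 = 0 and
    d_k - d_(k+1) = u_k - pi_k; d is [excess] below. As long as some queue is
    empty, every customer of the shared stream joins an empty queue, and the
    mean drift of d is linear:
      lambda (d_(k-1) - d_k) - mu (d_k - d_(k+1)).
    For a convex Psi with derivative psi, psi(0) = 0, this flow dissipates
    sum_k Psi(d_k) at a rate at least
      lambda sum_k (d_k - d_(k+1)) (psi(d_k) - psi(d_(k+1))),
    because lambda <= mu.

    The difficulty is the states without empty queue, where the shared stream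
    feeds a higher level m+1 and the drift gains the term
    lambda_s (psi(d_(m+1)) - psi(d_1)). In those states s_1 = 1, hence d_1 is
    exactly c = 1 - rho. Taking psi(d) = min(d, c), i.e. a quadratic Psi made
    linear beyond c, turns d_1 = c into a maximum of psi, and the extra term is
    nonpositive ([shortest_clip]). The same Lyapunov function thus works in all
    states.

    A jump moves one d_k by 1/N and the total jump rate is at most
    N (lambda + lambda_s + mu), so the random fluctuations cost at most
    (lambda + lambda_s + mu) / (2 N). Only K levels are kept, to have a bounded
    function; the error made is nonpositive when all queues are shorter than K
    and bounded otherwise ([boundary_term_le]). This is the drift inequality
    [generator_lyapunov_le].

    In a stationary state the mean of the generator is nonnegative on bounded
    functions, up to the mass that is left out of the sum
    ([stationary_generator_ge]); only functions of the occupancy are used,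
    since it is the law of the occupancy that is stationary
    ([stationary_occupancy_expect]). With K large this yields
      lambda E sum_k (psi(d_k) - psi(d_(k+1)))^2
        <= (lambda + lambda_s + mu) / (2 N),
    which is [stationary_dissipation_le]. Since psi(d_0) = 0 and
    |psi(d)| >= c |d| for |d| <= 1, each d_k, hence each u_k - pi_k, tends to 0
    in probability ([stationary_occupancy_far_le]). Convergence in probability
    of the coordinates to constants is weak convergence to a point mass
    ([seqspace_concentrate], [weak_cvg_on_dirac]). *)

(** * Sums over countable types *)

Lemma sum_affine {R : comPzRingType} {I : Type} (s : seq I) (a b e : R) (w f g : I -> R) :
  \sum_(x <- s) w x * (a * f x + b * g x + e)
  = a * (\sum_(x <- s) w x * f x) + b * (\sum_(x <- s) w x * g x)
    + e * (\sum_(x <- s) w x).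
Proof.
by rewrite !mulr_sumr -!big_split/=; apply: eq_bigr => x _; ring.
Qed.

Lemma sum_fset_delta (R : pzSemiRingType) (S : choiceType) (F : {fset S}) (z : S)
    (a : S -> R) : z \in F -> \sum_(x <- F) (z == x)%:R * a x = a z.
Proof.
move=> zF; rewrite (bigD1_seq z)//= eqxx mul1r big1 ?addr0// => x.
by rewrite eq_sym => /negbTE ->; rewrite mul0r.
Qed.

Section CountableSums.
Context {R : realType} {S : choiceType}.
Implicit Types (a : S -> \bar R) (p f : S -> R) (F : {fset S}) (A : set S).

Lemma esumZl (c : R) A a : 0 <= c -> (forall x, 0 <= a x)%E ->
  (\esum_(x in A) (c%:E * a x) = c%:E * \esum_(x in A) a x)%E.
Proof.
move=> c0 a0; rewrite /esum -ereal_supZl//; last first.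
  by apply/set0P; exists (\sum_(x \in set0) a x)%E, set0 => //; exact: fsets_set0.
rewrite image_comp; congr ereal_sup; apply: eq_imagel => X -[finX _] /=.
by rewrite !fsbig_finite//= ge0_sume_distrr.
Qed.

Lemma esum_fsetE F a : (forall x, 0 <= a x)%E ->
  (\esum_(x in [set` F]) a x = \sum_(x <- F) a x)%E.
Proof.
move=> a0; rewrite esum_fset//.
by rewrite fsbig_finite//= set_fsetK.
Qed.

Lemma esumID_fset F a : (forall x, 0 <= a x)%E ->
  (\esum_(x in [set: S]) a x
   = \sum_(x <- F) a x + \esum_(x in ~` [set` F]) a x)%E.
Proof. by move=> a0; rewrite (esumID [set` F])// !setTI esum_fsetE. Qed.

Lemma prob_mass_tail p F : prob_mass p ->
  (\esum_(x in ~` [set` F]) (p x)%:E = (1 - \sum_(x <- F) p x)%:E)%E.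
Proof.
move=> [p0]; rewrite (esumID_fset F)=> [|x]; last by rewrite lee_fin.
rewrite sumEFin addeC => /(congr1 (fun y => y - (\sum_(x <- F) p x)%:E)%E).
by rewrite addeK// EFinB.
Qed.

Lemma sum_prob_mass_le1 p F : prob_mass p -> \sum_(x <- F) p x <= 1.
Proof.
move=> pp; rewrite -subr_ge0 -lee_fin -prob_mass_tail//.
by apply: esum_ge0 => x _; rewrite lee_fin; case: pp.
Qed.

(** Replacing f by its upper bound M outside F: a finite sum then suffices to
    estimate an expectation from above. *)
Lemma prob_mass_expect_le (M : R) p f F : 0 <= M -> prob_mass p ->
  (forall x, 0 <= f x <= M) ->
  (\esum_(x in [set: S]) (p x * f x)%:E
   <= (\sum_(x <- F) p x * f x + M * (1 - \sum_(x <- F) p x))%:E)%E.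
Proof.
move=> M0 pp fM; have p0 := pp.1.
rewrite (esumID_fset F)=> [|x]; last first.
  by rewrite lee_fin mulr_ge0//; case/andP: (fM x).
rewrite sumEFin EFinD leeD2l// EFinM -prob_mass_tail// -esumZl//=.
apply: le_esum => x _; rewrite -EFinM lee_fin mulrC ler_wpM2r//.
by case/andP: (fM x).
Qed.

Lemma sum_fset_sub (A B : {fset S}) (a : S -> R) : (A `<=` B)%fset ->
  \sum_(x <- A) a x = \sum_(x <- B) (if x \in A then a x else 0).
Proof.
move=> AB.
rewrite [LHS]big_seq (eq_bigr (fun x => if x \in A then a x else 0)) => [|x ->//].
by rewrite -big_seq; apply: big_fset_incl => // x _ /negbTE ->.
Qed.

Lemma ler_sum_fset (A B : {fset S}) (a : S -> R) : (A `<=` B)%fset ->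
  (forall x, 0 <= a x) -> \sum_(x <- A) a x <= \sum_(x <- B) a x.
Proof.
move=> AB a0; rewrite (sum_fset_sub A B)//.
by apply: ler_sum => x _; case: ifP.
Qed.

Lemma prob_mass_exhaust (p : S -> R) (Z : {fset S}) (e : R) : prob_mass p -> 0 < e ->
  exists Z' : {fset S}, (Z `<=` Z')%fset /\ 1 - \sum_(x <- Z') p x <= e.
Proof.
move=> [p0 p1] e0.
have : ((1 - e)%:E < \esum_(x in [set: S]) (p x)%:E)%E.
  by rewrite p1 lte_fin gtrBl.
move=> /ereal_sup_gt[_ [X [finX _] <-]].
rewrite fsbig_finite//= sumEFin lte_fin => ltX.
exists (Z `|` fset_set X)%fset; split; first exact: fsubsetUl.
have := ler_sum_fset _ _ p (fsubsetUr Z (fset_set X)) p0; lra.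
Qed.

End CountableSums.

Section Fibers.
Context {R : realType} {S T : choiceType}.

Lemma exchange_esum (a : S -> T -> \bar R) : (forall x y, 0 <= a x y)%E ->
  (\esum_(x in [set: S]) \esum_(y in [set: T]) a x y
   = \esum_(y in [set: T]) \esum_(x in [set: S]) a x y)%E.
Proof.
move=> a0; rewrite !esum_esum//.
rewrite (reindex_esum ([set: T] `*`` (fun=> [set: S])) _ (fun z => (z.2, z.1)))//.
by split=> [[? ?]//|[? ?] [? ?] _ _ [-> ->]//|[x y] _]; exists (y, x).
Qed.

Lemma esum_fibers (e : S -> T) (a : S -> \bar R) : (forall x, 0 <= a x)%E ->
  (\esum_(x in [set: S]) a x
   = \esum_(y in [set: T]) \esum_(x in [set x | e x = y]) a x)%E.
Proof.
move=> a0; rewrite (@esum_esum _ _ _ _ _ (fun _ => a))//.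
rewrite (reindex_esum setT _ (fun x => (e x, x)))//.
split=> [x//|x y _ _ [] _ //|[y x] /= [_ <-]]; by exists x.
Qed.

(** Weights with the same total on each fibre of e cannot be told apart by a
    function that factors through e. *)
Lemma esum_comp_fibers (e : S -> T) (a b : S -> \bar R) (F : T -> R) :
  (forall x, 0 <= a x)%E -> (forall x, 0 <= b x)%E -> (forall y, 0 <= F y) ->
  (forall y, \esum_(x in [set x | e x = y]) a x
             = \esum_(x in [set x | e x = y]) b x)%E ->
  (\esum_(x in [set: S]) ((F (e x))%:E * a x)
   = \esum_(x in [set: S]) ((F (e x))%:E * b x))%E.
Proof.
move=> a0 b0 F0 ab.
rewrite (esum_fibers e) => [|x]; last by rewrite mule_ge0// lee_fin.
rewrite [RHS](esum_fibers e) => [|x]; last by rewrite mule_ge0// lee_fin.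
apply: eq_esum => y _.
transitivity ((F y)%:E * \esum_(x in [set x | e x = y]) a x)%E.
  by rewrite -esumZl//; apply: eq_esum => x /= ->.
by rewrite ab -esumZl//; apply: eq_esum => x /= ->.
Qed.

End Fibers.

(** * Transition functions and their generators *)

Lemma bernoulli_ineq (R : realDomainType) (a : R) n : 0 <= 1 + a ->
  1 + n%:R * a <= (1 + a) ^+ n.
Proof.
move=> a1; elim: n => [|n IHn]; first by rewrite expr0 mul0r addr0.
rewrite exprSr (le_trans _ (ler_wpM2r a1 IHn))//.
rewrite [leRHS](_ : _ = 1 + n.+1%:R * a + n%:R * a ^+ 2); last first.
  by rewrite -(natr1 n); ring.
by rewrite lerDl mulr_ge0// ?ler0n ?sqr_ge0.
Qed.

Section TransitionFunction.
Context {R : realType} {S : choiceType}.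
Variables (q : S -> S -> R) (P : R -> S -> S -> R).
Hypothesis PP : transition_function q P.

Lemma transition_prob_mass t x : 0 <= t -> prob_mass (P t x).
Proof. by case: PP => P0 P1 _ _ _ t0; split=> [y|]; [exact: P0|exact: P1]. Qed.

(** Not moving in n successive steps of length t is one way to be back. *)
Lemma transition_return_exprn t n x : 0 <= t ->
  P t x x ^+ n <= P (n%:R * t) x x.
Proof.
case: PP => P0 P1 Pid Padd _ t0; elim: n => [|n IHn].
  by rewrite mul0r Pid eqxx expr0.
have nt0 : 0 <= n%:R * t by rewrite mulr_ge0.
rewrite exprSr (le_trans (ler_wpM2r (P0 _ _ _ t0) IHn))//.
rewrite -(natr1 n) mulrDl mul1r -lee_fin Padd//.
have terms_ge0 y : (0 <= (P (n%:R * t) x y * P t y x)%:E)%E.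
  by rewrite lee_fin mulr_ge0// P0.
rewrite -(@esum_set1 _ _ x (fun y => (P (n%:R * t) x y * P t y x)%:E))//.
by rewrite [leRHS](esumID [set x])// setTI leeDl// esum_ge0.
Qed.

(** The chain does not move at all up to time t with probability exp(q x x t),
    which is at least 1 + q x x t. The exponential is avoided: cut t into n
    equal steps, use the derivative of P at 0 on one step, and apply the
    Bernoulli inequality to the n-th power. *)
Lemma transition_return_ge t x : 0 <= t -> 1 + q x x * t <= P t x x.
Proof.
rewrite le_eqVlt => /predU1P[<-|t0].
  by case: PP => _ _ Pid _ _; rewrite mulr0 addr0 Pid eqxx.
apply/ler_addgt0Pl => e e0.
have [_ _ _ _ Pq] := PP.
have /cvgr_gt/(_ (q x x - e / t)) : (P h x x - 1) / h @[h --> 0^'+] --> q x x.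
  by have := Pq x x; rewrite eqxx.
rewrite ltrBlDr ltrDl divr_gt0// => /(_ isT) [d /= d0 dP].
pose b := q x x - e / t.
(* The first summand puts t / n where the derivative estimate holds, the second
   makes the base 1 + b t / n of the power nonnegative. *)
pose n := (Num.truncn (t / d + `|b| * t)).+1.
have nlt : t / d + `|b| * t < n%:R by rewrite /n truncnS_gt.
have n0 : 0 < n%:R :> R by rewrite ltr0n.
have td0 : 0 < t / d by rewrite divr_gt0.
have bt0 : 0 <= `|b| * t by rewrite mulr_ge0// ltW.
have h0 : 0 < t / n%:R by rewrite divr_gt0.
have hd : t / n%:R < d by rewrite ltr_pdivrMr// mulrC -ltr_pdivrMr//; lra.
have bh1 : `|b * (t / n%:R)| <= 1.
  by rewrite normrM (gtr0_norm h0) mulrA ler_pdivrMr//; lra.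
have bh0 : 0 <= 1 + b * (t / n%:R) by move: bh1; rewrite ler_norml; lra.
have Ph : 1 + b * (t / n%:R) <= P (t / n%:R) x x.
  have := dP (t / n%:R); rewrite /= sub0r normrN gtr0_norm// => /(_ hd h0).
  by rewrite ltr_pdivlMr// -/b => /ltW; lra.
have Pn : P (t / n%:R) x x ^+ n <= P t x x.
  by have := transition_return_exprn _ n x (ltW h0); rewrite (mulrC n%:R) divfK ?gt_eqF.
have := bernoulli_ineq _ _ n bh0.
have : (1 + b * (t / n%:R)) ^+ n <= P (t / n%:R) x x ^+ n.
  by apply: lerXn2r; rewrite ?nnegrE// (le_trans bh0).
have -> : n%:R * (b * (t / n%:R)) = b * t by field; rewrite gt_eqF.
have -> : b * t = q x x * t - e by rewrite /b; field; rewrite gt_eqF.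
lra.
Qed.

(** Formally the mean of the generator applied to f under a stationary nu is 0;
    here is a one-sided version for partial sums, with an error paid by the mass
    outside Z. There, the mean of f grows by at most M Q h in
    time h, because f is at most M and a state is left with probability at most
    Q h. Stationarity forces the mean over Z to compensate for that growth;
    divide by h and let h tend to 0. *)
Lemma stationary_generator_ge (supp : S -> {fset S}) (M Q : R) (nu f : S -> R)
    (Z : {fset S}) :
  (forall z, z \in supp z) ->
  (forall z, \sum_(x <- supp z) q z x = 0) ->
  (forall z, - Q <= q z z) ->
  (forall x, 0 <= f x <= M) ->
  prob_mass nu ->
  (forall t, 0 <= t ->
    (\esum_(z in [set: S])
        ((nu z)%:E * \esum_(x in [set: S]) (P t z x * f x)%:E)
     = \esum_(z in [set: S]) (nu z * f z)%:E)%E) ->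
  - (M * Q) * (1 - \sum_(z <- Z) nu z)
    <= \sum_(z <- Z) nu z * \sum_(x <- supp z) q z x * f x.
Proof.
move=> suppz q0 qQ fM nuP stat.
have f0 x : 0 <= f x by case/andP: (fM x).
have [x0|S0] := pselect (exists x : S, True); last first.
  have Znil : forall z : S, False by move=> z; apply: S0; exists z.
  have [_] := nuP; rewrite esum1=> [/eqP|z]; last by have := Znil z.
  by rewrite eq_sym onee_eq0.
case: x0 => z0 _.
have M0 : 0 <= M by have /andP[] := fM z0; exact: le_trans.
have nu0 := nuP.1.
(* An upper bound for the increment quotient of the mean of f started at z: f is
   replaced by M outside supp z, so that a finite sum remains. *)
pose B (h : R) z := \sum_(x <- supp z) ((P h z x - (z == x)%:R) / h) * (f x - M).
have [_ _ _ _ Pq] := PP.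
have Bcvg : \sum_(z <- Z) nu z * B h z @[h --> 0^'+] -->
    \sum_(z <- Z) nu z * \sum_(x <- supp z) q z x * f x.
  have -> : \sum_(z <- Z) nu z * \sum_(x <- supp z) q z x * f x =
            \sum_(z <- Z) nu z * \sum_(x <- supp z) q z x * (f x - M).
    apply: eq_bigr => z _; congr (_ * _).
    under [RHS]eq_bigr do rewrite mulrBr.
    by rewrite sumrB -mulr_suml q0 mul0r subr0.
  apply: cvg_big => [|z _]; first exact: add_continuous.
  apply: cvgM; [exact: cvg_cst|apply: cvg_big => [|x _]].
    exact: add_continuous.
  by apply: cvgM; [exact: Pq|exact: cvg_cst].
apply: (cvgr_to_ge Bcvg).
near=> h.
have h0 : 0 < h by near: h; exact: nbhs_right_gt.
have P0 x y : 0 <= P h x y by case: PP => P0 *; exact/P0/ltW.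
have Pmass x := transition_prob_mass h x (ltW h0).
pose g z := (\esum_(x in [set: S]) (P h z x * f x)%:E)%E.
have g0 z : (0 <= g z)%E by apply: esum_ge0 => x _; rewrite lee_fin mulr_ge0.
have gB z : (g z <= (f z + h * B h z)%:E)%E.
  apply: le_trans (prob_mass_expect_le _ _ _ (supp z) M0 (Pmass z) fM) _.
  have -> : h * B h z = \sum_(x <- supp z) P h z x * (f x - M)
                       - \sum_(x <- supp z) (z == x)%:R * (f x - M).
    rewrite -sumrB mulr_sumr; apply: eq_bigr => x _.
    by rewrite mulrA mulrCA mulfV ?gt_eqF// mulr1 mulrBl.
  rewrite sum_fset_delta//.
  have -> : \sum_(x <- supp z) P h z x * (f x - M)
          = \sum_(x <- supp z) P h z x * f x - (\sum_(x <- supp z) P h z x) * M.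
    by rewrite mulr_suml -sumrB; apply: eq_bigr => x _; rewrite mulrBr.
  rewrite lee_fin; lra.
have Q0 : 0 <= Q.
  have := transition_return_ge 1 z0 ler01; have := qQ z0.
  have := sum_prob_mass_le1 _ [fset z0]%fset (transition_prob_mass 1 z0 ler01).
  by rewrite big_seq_fset1; lra.
have gQ z : (g z <= (f z + M * Q * h)%:E)%E.
  apply: le_trans (prob_mass_expect_le _ _ _ [fset z]%fset M0 (Pmass z) fM) _.
  rewrite !big_seq_fset1 lee_fin.
  have := transition_return_ge h z (ltW h0).
  have := sum_prob_mass_le1 _ [fset z]%fset (Pmass z).
  rewrite big_seq_fset1 => P1 Pq1.
  have : P h z z * f z <= f z by rewrite ler_piMl.
  have : M * (1 - P h z z) <= M * (Q * h).
    apply: ler_wpM2l => //; have := ler_wpM2r (ltW h0) (qQ z); lra.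
  lra.
have := stat h (ltW h0).
rewrite (esumID_fset Z) => [|x]; last first.
  by apply: mule_ge0; [rewrite lee_fin|exact: g0].
rewrite [RHS](esumID_fset Z) => [|x]; last by rewrite lee_fin mulr_ge0.
set Tg := esum _ _; set Tf := esum _ _ => gf.
have MQh0 : 0 <= M * Q * h by rewrite !mulr_ge0// ltW.
have TgTf : (Tg <= Tf + (M * Q * h * (1 - \sum_(z <- Z) nu z))%:E)%E.
  rewrite EFinM -prob_mass_tail// -esumZl//.
  have nuf0 x : (0 <= (nu x * f x)%:E)%E by rewrite lee_fin mulr_ge0.
  have nuc0 x : (0 <= (M * Q * h)%:E * (nu x)%:E)%E.
    by rewrite -EFinM lee_fin !mulr_ge0// ltW.
  rewrite -esumD//.
  apply: le_esum => x _.
  apply: le_trans (lee_wpmul2l _ (gQ x)) _; first by rewrite lee_fin.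
  by rewrite -EFinM -EFinM -EFinD lee_fin mulrDr [_ * nu x]mulrC.
have Tffin : Tf \is a fin_num.
  rewrite ge0_fin_numE; last by apply: esum_ge0 => x _; rewrite lee_fin mulr_ge0.
  apply: (@le_lt_trans _ _ (M * (1 - \sum_(z <- Z) nu z))%:E); last exact: ltry.
  rewrite EFinM -prob_mass_tail// -esumZl//.
  apply: le_esum => x _; rewrite -EFinM lee_fin mulrC ler_wpM2r//.
  by case/andP: (fM x).
have : (\sum_(z <- Z) (nu z * f z)%:E + Tf <=
  \sum_(z <- Z) (nu z * (f z + h * B h z))%:E
  + (Tf + (M * Q * h * (1 - \sum_(z <- Z) nu z))%:E))%E.
  rewrite -gf leeD//; apply: lee_sum => z _.
  by rewrite [leRHS]EFinM; apply: lee_wpmul2l (gB z); rewrite lee_fin.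
rewrite !sumEFin -(fineK Tffin) -!EFinD lee_fin.
have -> : \sum_(z <- Z) nu z * (f z + h * B h z) =
    \sum_(z <- Z) nu z * f z + h * \sum_(z <- Z) nu z * B h z.
  by rewrite mulr_sumr -big_split; apply: eq_bigr => z _ /=; ring.
move=> bound; rewrite -subr_ge0 -(pmulr_rge0 _ h0); lra.
Unshelve. all: by end_near.
Qed.

End TransitionFunction.

(** * Weak convergence to a point mass *)

Section WeakConvergenceToPoint.
Context {R : realType} {T : ptopologicalType}.

Lemma open_borel_measurable (U : set (borel T)) :
  open (U : set T) -> measurable U.
Proof. by move=> oU; exact: sub_sigma_algebra. Qed.

Lemma closed_borel_measurable (U : set (borel T)) :
  closed (U : set T) -> measurable U.
Proof.
move=> /closed_openC /(open_borel_measurable (~` U)) /measurableC.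
by rewrite setCK.
Qed.

Lemma within_continuous_borel_measurable (E : set (borel T)) (f : T -> R) :
  measurable E -> {within (E : set T), continuous f} ->
  measurable_fun E (f : borel T -> R).
Proof.
move=> mE /continuousP cf.
apply: (measurability _ (RGenOpens.measurableE R)).
move=> _ [_ [a [b ->] <-]].
have /open_subspaceP [V oV VE] : open (f @^-1` `]a, b[ : set (subspace E)).
  exact/cf/interval_open.
by rewrite setIC -VE; apply: measurableI => //; exact: open_borel_measurable.
Qed.

(** On U the integrand is within e of f a, and off U it is at distance at most
    2 M. *)
Lemma integral_borel_near_point (mu : probability (borel T) R)
    (E U : set (borel T)) (f : T -> R) (a : T) (e M : R) :
  measurable E -> mu E = 1%E -> measurable U ->
  measurable_fun E (f : borel T -> R) -> 0 <= e -> E a ->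
  (forall x, E x -> `|f x| <= M) ->
  (forall x, E x -> U x -> `|f x - f a| <= e) ->
  (`|\int[mu]_(x in E) (f x)%:E - (f a)%:E| <= e%:E + (2 * M)%:E * mu (~` U))%E.
Proof.
move=> mE muE mU mf e0 Ea fM fU.
have M0 : 0 <= M by apply: le_trans (fM _ Ea).
have mufin : (mu E < +oo)%E by rewrite muE ltry.
have fint : mu.-integrable E (fun x => (f x)%:E).
  apply: measurable_bounded_integrable => //.
  exists M; split; first exact: num_real.
  by move=> y My x Ex; apply: le_trans (fM x Ex) (ltW My).
have cint : mu.-integrable E (fun x => (f a)%:E).
  apply: measurable_bounded_integrable => //.
  exists M; split; first exact: num_real.
  by move=> y My x Ex; apply: le_trans (fM _ Ea) (ltW My).
have -> : ((f a)%:E = \int[mu]_(x in E) (f a)%:E)%E.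
  rewrite integral_cst// -[LHS]mule1; congr (_ * _)%E.
  by rewrite -muE.
rewrite -integralB//.
have mg : measurable_fun E (EFin \o ((f : borel T -> R) \- cst (f a))).
  by apply/measurable_EFinP; apply: measurable_funB.
apply: le_trans (le_abse_integral mu mE mg) _.
have mUc : measurable (~` U) by exact: measurableC.
have mind : measurable_fun E (fun x : borel T => (2 * M)%:E * (\1_(~` U) x)%:E)%E.
  apply: emeasurable_funM; first exact: measurable_cst.
  apply/measurable_EFinP; exact: measurable_indic.
have rhsE : (\int[mu]_(x in E) (e%:E + (2 * M)%:E * (\1_(~` U) x)%:E)
    = e%:E * mu E + (2 * M)%:E * mu (~` U `&` E))%E.
  rewrite ge0_integralD//; last first.
    by move=> x _; rewrite -EFinM lee_fin !mulr_ge0.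
  rewrite integral_cst//; congr (_ + _)%E.
  rewrite ge0_integralZl//; first by rewrite integral_indic.
    by apply/measurable_EFinP; exact: measurable_indic.
  by rewrite lee_fin mulr_ge0.
apply: (@le_trans _ _ (e%:E * mu E + (2 * M)%:E * mu (~` U `&` E))%E); last first.
  rewrite muE mule1; apply: leeD2l.
  apply: lee_wpmul2l; first by rewrite lee_fin mulr_ge0.
  by apply: le_measure; rewrite ?inE//; exact: measurableI.
rewrite -rhsE; apply: ge0_le_integral => //.
- exact: measurableT_comp.
- by apply: emeasurable_funD.
move=> x Ex /=; rewrite -EFinM -EFinD lee_fin indicE.
have [Ux|nUx] := pselect (U x).
  by rewrite memNset ?mulr0 ?addr0; [exact: fU|exact].
rewrite mem_set// mulr1 (le_trans (ler_normB _ _))//.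
have := fM _ Ex; have := fM _ Ea; lra.
Qed.

Lemma weak_cvg_on_dirac (E : set T) (mu_ : nat -> probability (borel T) R)
    (a : T) :
  measurable (E : set (borel T)) -> E a ->
  (\forall n \near \oo, mu_ n (E : set (borel T)) = 1%E) ->
  (forall U : set T, open U -> U a -> forall e : R, 0 < e ->
     \forall n \near \oo, (mu_ n (~` U : set (borel T)) <= e%:E)%E) ->
  weak_cvg_on E (fun n => mu_ n) (dirac (a : borel T)).
Proof.
move=> mE Ea muE muU f cf [M fM].
have mf := within_continuous_borel_measurable _ _ mE cf.
rewrite integral_dirac//; last exact/measurable_EFinP.
rewrite diracE mem_set// mul1e.
have fa_near (e : R) : 0 < e -> \forall n \near \oo,
    (`|\int[mu_ n]_(x in (E : set (borel T))) (f x)%:E - (f a)%:E| <= e%:E)%E.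
  move=> e0.
  have : \forall x \near within E (nbhs a), `|f x - f a| <= e / 2.
    rewrite nbhs_subspace_in//.
    have /cvgrPdist_le/(_ (e / 2)) : f x @[x --> (a : subspace E)] --> f a.
      exact: cf.
    rewrite divr_gt0// => /(_ isT); apply: filterS => x; by rewrite distrC.
  rewrite /within /= nbhsE => -[U [oU Ua] UfE].
  have M0 : 0 <= M by apply: le_trans (fM _ Ea).
  have d0 : 0 < e / 2 / (2 * M + 1) by rewrite !divr_gt0//; lra.
  have := muU U oU Ua _ d0; apply: filterS2 muE => n nE nU.
  have := @integral_borel_near_point (mu_ n) E U f a (e / 2) M mE nE
    (open_borel_measurable _ oU) mf (ltW (divr_gt0 e0 (ltr0Sn R 1))) Ea fM
    (fun x Ex Ux => UfE x Ux Ex).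
  move=> /le_trans; apply.
  apply: (@le_trans _ _ ((e / 2)%:E + (2 * M)%:E * (e / 2 / (2 * M + 1))%:E)%E).
    by apply: leeD2l; apply: lee_wpmul2l nU; rewrite lee_fin mulr_ge0.
  rewrite -EFinM -EFinD lee_fin.
  have : 2 * M * (e / 2 / (2 * M + 1)) <= e / 2; last lra.
  rewrite mulrCA ler_piMr ?divr_ge0//; first lra.
  by rewrite ler_pdivrMr; lra.
apply/fine_cvgP; split.
  have := fa_near 1 ltr01; apply: filterS => n.
  case: (integral _ _ _) => //.
apply/cvgrPdist_le => e /fa_near; apply: filterS => n /=.
by case: (integral _ _ _) => [r| |] //=; rewrite lee_fin distrC.
Qed.

End WeakConvergenceToPoint.

(** * Sequences with componentwise convergence *)

Section SequenceSpace.
Context {R : realType}.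

Lemma coord_continuous k : continuous (fun u : seqspace R => u k).
Proof. exact: (@proj_continuous nat (fun=> R) k). Qed.

Lemma seqspace_set1_measurable (v : seqspace R) :
  measurable ([set v] : set (borel (seqspace R))).
Proof.
apply: closed_borel_measurable; apply: accessible_closed_set1.
apply: hausdorff_accessible.
by apply: (@hausdorff_product nat (fun=> R)) => _; exact: Rhausdorff.
Qed.

Lemma cube_measurable : measurable (cube R : set (borel (seqspace R))).
Proof.
apply: closed_borel_measurable.
have -> : cube R = \bigcap_k ((fun u : seqspace R => u k) @^-1` `[0, 1]).
  apply/seteqP; split => u /=.
    by move=> uc k _; rewrite /= in_itv; exact: uc.
  by move=> uc k; have := uc k I; rewrite /= in_itv.
apply: closed_bigI => k _; apply: preimage_closed; last exact: interval_closed.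
by move=> u _; exact: coord_continuous.
Qed.

Definition coord_far (k : nat) (c e : R) : set (borel (seqspace R)) :=
  [set u | e <= `|(u : seqspace R) k - c|].

Lemma coord_far_measurable k (c e : R) : measurable (coord_far k c e).
Proof.
apply: closed_borel_measurable.
have far_closed : closed [set x : R | e <= `|x - c|].
  apply: (@preimage_closed _ _ (fun x : R => `|x - c|) [set x | e <= x]).
    by move=> x _; apply: cvg_norm; apply: cvgB; [exact: cvg_id|exact: cvg_cst].
  exact: closed_ge.
apply: (@preimage_closed _ _ (fun u : seqspace R => u k) _ _ far_closed).
by move=> u _; exact: coord_continuous.
Qed.

(** The sets that carry almost all the mass in the limit form a filter. Each
    coordinate converges along it, so the filter itself converges, by the
    universal property of the product topology. *)
Lemma seqspace_concentrate (mu_ : nat -> probability (borel (seqspace R)) R)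
    (a : seqspace R) :
  (forall k (e d : R), 0 < e -> 0 < d -> \forall n \near \oo,
     (mu_ n (coord_far k (a k) e) <= d%:E)%E) ->
  forall U : set (seqspace R), open U -> U a -> forall d : R, 0 < d ->
    \forall n \near \oo, (mu_ n (~` U : set (borel (seqspace R))) <= d%:E)%E.
Proof.
move=> mu_coord.
pose F : set_system (seqspace R) := [set A : set (seqspace R) |
  forall d : R, 0 < d -> exists B : set (borel (seqspace R)),
    [/\ measurable B, ~` A `<=` B & \forall n \near \oo, (mu_ n B <= d%:E)%E]].
have FF : Filter F.
  split.
  - move=> d d0; exists set0; split => //; first by rewrite setCT.
    by apply: nearW => n; rewrite measure0 lee_fin ltW.
  - move=> A B FA FB d d0; have d20 : 0 < d / 2 by rewrite divr_gt0.
    have [A' [mA' AA' nA']] := FA _ d20; have [B' [mB' BB' nB']] := FB _ d20.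
    exists (A' `|` B'); split; first exact: measurableU.
      by rewrite setCI; exact: setUSS.
    apply: filterS2 nA' nB' => n nA' nB'.
    apply: le_trans (measureU2 _ mA' mB') _.
    by rewrite (splitr d) EFinD leeD.
  - move=> A B AB FA d /FA [A' [mA' AA' nA']]; exists A'; split => //.
    by apply: subset_trans AA'; exact: subsetC.
have Fa : F --> a.
  apply: (iffRL (@pointwise_cvgP nat R F a FF)) => k.
  apply/cvgrPdist_lt => e e0 d d0.
  exists (coord_far k (a k) e); split.
  - exact: coord_far_measurable.
  - by move=> u /= /negP; rewrite -leNgt distrC.
  - exact: mu_coord.
move=> U oU Ua d d0.
have FU : F U by apply: Fa; exact: open_nbhs_nbhs.
have [B [mB UB nB]] := FU d d0.
apply: filterS nB => n nB; apply: le_trans nB.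
apply: le_measure; rewrite ?inE//.
by apply: closed_borel_measurable; exact: open_closedC.
Qed.

End SequenceSpace.

(** * Stationarity of the occupancy *)

(** Stationarity is known only for the occupancy, but singletons of the sequence
    space are measurable, so the laws of the configuration at times 0 and t
    agree on each fibre of the occupancy map. *)
Lemma stationary_occupancy_expect {R : realType} (N : nat)
    (q : config N -> config N -> R) (P : R -> config N -> config N -> R)
    (nu : config N -> R) (F : seqspace R -> R) :
  transition_function q P -> prob_mass nu ->
  (forall (t : R) (A : set (borel (seqspace R))), 0 <= t -> measurable A ->
     occupancy_law (law_at P nu t) A = occupancy_law (fun x => (nu x)%:E) A) ->
  (forall u, 0 <= F u) ->
  forall t : R, 0 <= t ->
  (\esum_(z in [set: config N])
      ((nu z)%:E * \esum_(x in [set: config N]) (P t z x * F (occupancy R x))%:E)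
   = \esum_(z in [set: config N]) (nu z * F (occupancy R z))%:E)%E.
Proof.
move=> [P0 _ _ _ _] [nu0 _] stat F0 t t0.
transitivity (\esum_(x in [set: config N]) ((F (occupancy R x))%:E * law_at P nu t x))%E.
  transitivity (\esum_(z in [set: config N]) \esum_(x in [set: config N])
      (nu z * P t z x * F (occupancy R x))%:E)%E.
    apply: eq_esum => z _; rewrite -esumZl//; last first.
      by move=> x; rewrite lee_fin mulr_ge0// P0.
    by apply: eq_esum => x _; rewrite -EFinM mulrA.
  rewrite exchange_esum => [|z x]; last by rewrite lee_fin !mulr_ge0// P0.
  apply: eq_esum => x _; rewrite /law_at -esumZl//.
    by apply: eq_esum => z _; rewrite -EFinM mulrC.
  by move=> z; rewrite lee_fin mulr_ge0// P0.
transitivity (\esum_(x in [set: config N]) ((F (occupancy R x))%:E * (nu x)%:E))%E.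
  apply: esum_comp_fibers => // [x|v].
    by apply: esum_ge0 => z _; rewrite lee_fin mulr_ge0// P0.
  exact: (stat t _ t0 (seqspace_set1_measurable v)).
by apply: eq_esum => x _; rewrite -EFinM mulrC.
Qed.

(** * A quadratic function with clipped derivative *)

Section ClippedQuadratic.
Context {R : realFieldType} (c : R).
Implicit Types x y : R.

(** The derivative of [clip_energy]. *)
Definition clip x := Num.min x c.

(** The function equal to x ^+ 2 / 2 up to c and affine beyond; in this form the
    two cases need not be separated. *)
Definition clip_energy x := clip x * x - clip x ^+ 2 / 2.

Lemma clip_cases x : x <= c /\ clip x = x \/ c <= x /\ clip x = c.
Proof. by rewrite /clip; case: (leP x c) => h; [left|right; split => //; exact: ltW]. Qed.

Lemma clip_le x : clip x <= c.
Proof. by rewrite ge_min lexx orbT. Qed.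

(** The map [clip] is nondecreasing and 1-Lipschitz. *)
Lemma clip_monotone x y :
  (clip x - clip y) ^+ 2 <= (x - y) * (clip x - clip y).
Proof.
by case: (clip_cases x) => -[xc ->]; case: (clip_cases y) => -[yc ->]; nra.
Qed.

Lemma clip_energy_convex x y :
  clip x * (y - x) <= clip_energy y - clip_energy x.
Proof.
rewrite /clip_energy; have := sqr_ge0 (y - x).
have := sqr_ge0 (y - c); have := sqr_ge0 (x - c).
case: (clip_cases x) => -[xc ->]; case: (clip_cases y) => -[yc ->].
- lra.
- have : 0 <= (c - x) * (y - c) by rewrite mulr_ge0 ?subr_ge0.
  lra.
- have : 0 <= (x - c) * (c - y) by rewrite mulr_ge0 ?subr_ge0.
  lra.
- lra.
Qed.

Lemma clip_energy_smooth x y :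
  clip_energy y - clip_energy x <= clip x * (y - x) + (y - x) ^+ 2 / 2.
Proof.
rewrite /clip_energy; have := sqr_ge0 (y - x).
have := sqr_ge0 (y - c); have := sqr_ge0 (x - c).
case: (clip_cases x) => -[xc ->]; case: (clip_cases y) => -[yc ->].
- lra.
- have : 0 <= (c - x) * (y - c) by rewrite mulr_ge0 ?subr_ge0.
  lra.
- have : 0 <= (x - c) * (c - y) by rewrite mulr_ge0 ?subr_ge0.
  lra.
- lra.
Qed.

Lemma clip_energy_ge0 x : 0 <= c -> 0 <= clip_energy x.
Proof. by rewrite /clip_energy => c0; case: (clip_cases x) => -[xc ->]; nra. Qed.

Lemma clip_energy_le x : 0 <= c -> clip_energy x <= x ^+ 2 / 2.
Proof. by rewrite /clip_energy => c0; case: (clip_cases x) => -[xc ->]; nra. Qed.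

Lemma clip_norm_le x : 0 <= c -> `|clip x| <= `|x|.
Proof.
move=> c0; case: (clip_cases x) => -[xc ->] //.
by rewrite ger0_norm// (le_trans xc) ?ler_norm.
Qed.

Lemma clip_norm_ge x : 0 <= c <= 1 -> `|x| <= 1 -> c * `|x| <= `|clip x|.
Proof.
move=> /andP[c0 c1] x1; case: (clip_cases x) => -[xc ->].
  by rewrite ler_piMl.
by rewrite (ger0_norm c0) ler_piMr.
Qed.

(** Dissipation of the linear birth and death flow with arrival rate a and
    service rate b, cut at level K. Summation by parts produces the products
    (d k - d k.+1) * (clip (d k) - clip (d k.+1)), bounded by [clip_monotone];
    the asymmetry b - a multiplies the sum of (d k - d k.+1) * clip (d k), which
    dominates a telescoping sum of energies by convexity. *)
Lemma clip_energy_drift (a b : R) (d : nat -> R) K :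
  0 <= a <= b -> d 0%N = 0 -> 0 <= c ->
  a * (\sum_(k < K) (d k - d k.+1) * clip (d k.+1))
  - b * (\sum_(k < K) (d k.+1 - d k.+2) * clip (d k.+1))
  <= - a * (\sum_(k < K) (clip (d k) - clip (d k.+1)) ^+ 2)
     + (b - a) * clip_energy (d K) - b * ((d K - d K.+1) * clip (d K)).
Proof.
move=> /andP[a0 ab] d0 c0; elim: K => [|K IHK].
  rewrite !big_ord0 d0 /clip_energy /clip min_l//; lra.
rewrite !big_ord_recr/=; move: IHK.
set A := \sum_(k < K) _; set B := \sum_(k < K) _; set W := \sum_(k < K) _.
have := ler_wpM2l a0 (clip_monotone (d K) (d K.+1)).
have ba : 0 <= b - a by rewrite subr_ge0.
have := ler_wpM2l ba (clip_energy_convex (d K) (d K.+1)).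
lra.
Qed.

Lemma clip_energy_sum_perturb (e : R) (d d' : nat -> R) m K :
  (forall k, d' k = d k + (k == m)%:R * e) ->
  \sum_(k < K) clip_energy (d' k.+1) - \sum_(k < K) clip_energy (d k.+1)
  <= (0 < m <= K)%N%:R * (clip (d m) * e) + e ^+ 2 / 2.
Proof.
move=> dd'; have e2 : 0 <= e ^+ 2 / 2 by rewrite divr_ge0 ?sqr_ge0.
rewrite -sumrB; case: (boolP (0 < m <= K)%N) => [|mK].
  case: m dd' => // m dd' /= mK; rewrite mulr1n mul1r.
  rewrite (bigD1 (Ordinal mK))//= big1 ?addr0 => [|k]; last first.
    by rewrite -val_eqE/= => km; rewrite dd' eqSS (negbTE km) mul0r addr0 subrr.
  have := clip_energy_smooth (d m.+1) (d' m.+1).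
  by have -> : d' m.+1 - d m.+1 = e by rewrite dd' eqxx mul1r addrAC subrr add0r.
rewrite mulr0n mul0r add0r big1// => k _.
rewrite dd' (_ : (k.+1 == m) = false) ?mul0r ?addr0 ?subrr//.
by apply: contraNF mK => /eqP <-; rewrite ltn_ord.
Qed.

End ClippedQuadratic.

(** * Occupancies and the generator of the queues *)

Section Occupancy.
Context {R : realType} {N : nat}.
Implicit Types (x : config N) (i : 'I_N) (k K : nat).

Lemma sum_occupancy x K (a : nat -> R) :
  \sum_(k < K) occupancy R x k * a k = (\sum_(i < N) (x i < K)%N%:R * a (x i)) / N%:R.
Proof.
rewrite mulr_suml.
transitivity (\sum_(k < K) \sum_(i < N) (x i == k)%:R * a k / N%:R).
  apply: eq_bigr => k _; rewrite /occupancy -sum1_card natr_sum big_mkcond/=.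
  rewrite mulrAC mulr_suml mulr_suml; apply: eq_bigr => i _.
  by rewrite inE; case: eqP.
rewrite exchange_big/=; apply: eq_bigr => i _.
case: ltnP => xiK.
  rewrite (bigD1 (Ordinal xiK))//= eqxx !mul1r big1 ?addr0// => k.
  by rewrite -val_eqE/= eq_sym => /negbTE ->; rewrite !mul0r.
rewrite !mul0r big1// => k _; case: eqP => [xik|]; last by rewrite !mul0r.
by have := ltn_ord k; rewrite -xik ltnNge xiK.
Qed.

Lemma occupancy_ge0 x k : 0 <= occupancy R x k.
Proof. by rewrite divr_ge0. Qed.

Lemma sum_occupancy1 x K :
  \sum_(k < K) occupancy R x k = (\sum_(i < N) (x i < K)%N%:R) / N%:R.
Proof.
under eq_bigr do rewrite -[occupancy _ _ _]mulr1.
by rewrite (sum_occupancy x K (fun=> 1)); under eq_bigr do rewrite mulr1.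
Qed.

Lemma sum_occupancy_le1 x K : (0 < N)%N -> \sum_(k < K) occupancy R x k <= 1.
Proof.
move=> N0; rewrite sum_occupancy1 ler_pdivrMr ?ltr0n// mul1r.
rewrite -[leRHS]mulr1 mulr_natl -[X in 1 *+ X]card_ord -sumr_const.
by apply: ler_sum => i _; case: (_ < _)%N; rewrite ?ler01.
Qed.

Lemma sum_occupancy_eq1 x K : (0 < N)%N -> (forall i, x i < K)%N ->
  \sum_(k < K) occupancy R x k = 1.
Proof.
move=> N0 xK; rewrite sum_occupancy1; under eq_bigr do rewrite xK.
by rewrite sumr_const card_ord divff// pnatr_eq0 -lt0n.
Qed.

Lemma occupancy_eq0 x k : (forall i, x i != k) -> occupancy R x k = 0.
Proof.
move=> xk; rewrite /occupancy (eq_card0 (A := [pred i | x i == k])) ?mul0r//.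
by move=> i; rewrite inE; exact/negbTE.
Qed.

Lemma occupancy_cube x : (0 < N)%N -> cube R (occupancy R x).
Proof.
move=> N0 k; rewrite occupancy_ge0/=.
apply: le_trans (sum_occupancy_le1 x k.+1 N0).
by rewrite big_ord_recr/= lerDr sumr_ge0// => j _; exact: occupancy_ge0.
Qed.

Lemma sum_occupancy_enter x i K :
  \sum_(k < K) occupancy R (enter x i) k
  = \sum_(k < K) occupancy R x k - (K == (x i).+1)%:R / N%:R.
Proof.
rewrite !sum_occupancy1 -mulrBl; congr (_ / _).
rewrite (bigD1 i)//= [in RHS](bigD1 i)//= addrAC; congr (_ + _).
  rewrite ffunE eqxx addn1 [(x i < K)%N]leq_eqVlt eq_sym.
  by case: eqVneq => [<-|_]; rewrite ?ltnn ?subrr ?subr0.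
by apply: eq_bigr => j ji; rewrite ffunE (negbTE ji) addn0.
Qed.

Lemma sum_occupancy_leave x i K : (0 < x i)%N ->
  \sum_(k < K) occupancy R (leave x i) k
  = \sum_(k < K) occupancy R x k + (K == x i)%:R / N%:R.
Proof.
move=> xi0; rewrite !sum_occupancy1 -mulrDl; congr (_ / _).
rewrite (bigD1 i)//= [in RHS](bigD1 i)//= addrAC; congr (_ + _).
  rewrite ffunE eqxx subn1; case: (x i) xi0 => // m _.
  rewrite [(m.+1.-1 < K)%N]leq_eqVlt eq_sym.
  by case: eqVneq => [->|_]; rewrite ?ltnn ?add0r ?addr0.
by apply: eq_bigr => j ji; rewrite ffunE (negbTE ji) subn0.
Qed.

Section Generator.
Variables (lambda lambda_s mu : R) (tie : config N -> 'I_N -> R).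
Local Notation q := (qrate lambda lambda_s mu tie).

Definition neighbours x : {fset config N} :=
  [fset y in x :: [seq enter x i | i : 'I_N] ++ [seq leave x i | i : 'I_N]]%fset.

(** The coefficient of g x in each jump term makes the rows of the Q-matrix sum
    to 0, so only differences of g appear. *)
Lemma sum_qrate x (g : config N -> R) :
  \sum_(y <- neighbours x) q x y * g y
  = \sum_(i < N) (lambda + N%:R * lambda_s * tie x i) * (g (enter x i) - g x)
  + \sum_(i < N) mu * (0 < x i)%N%:R * (g (leave x i) - g x).
Proof.
have delta (y : config N) : y \in neighbours x ->
    \sum_(z <- neighbours x) ((z == y)%:R - (z == x)%:R) * g z = g y - g x.
  move=> yx; under eq_bigr => z _ do rewrite mulrBl (eq_sym z y) (eq_sym z x).
  rewrite sumrB !sum_fset_delta//.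
  by rewrite !inE eqxx.
under eq_bigr do rewrite mulrDl !mulr_suml.
rewrite big_split/=; congr (_ + _); rewrite exchange_big/=; apply: eq_bigr => i _.
  under eq_bigr do rewrite -mulrA.
  by rewrite -mulr_sumr delta// in_fset inE mem_cat fintype.image_f ?orbT.
under eq_bigr do rewrite -mulrA.
by rewrite -mulr_sumr delta// in_fset inE mem_cat fintype.image_f ?orbT.
Qed.

Lemma sum_qrate0 x : \sum_(y <- neighbours x) q x y = 0.
Proof.
under eq_bigr do rewrite -[q _ _]mulr1.
rewrite (sum_qrate x (fun=> 1)) subrr.
by rewrite !big1 ?addr0// => i _; rewrite mulr0.
Qed.

Hypotheses (lambda0 : 0 <= lambda) (lambda_s0 : 0 <= lambda_s) (mu0 : 0 <= mu).
Hypothesis tieP : tie_rule tie.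

Lemma qrate_diag_ge x : - (N%:R * (lambda + lambda_s + mu)) <= q x x.
Proof.
have [tie0 _ tie1] := tieP x.
have term (r : R) (b : bool) : 0 <= r -> - r <= r * (b%:R - 1).
  by move=> r0; case: b; rewrite ?subrr ?mulr0 ?sub0r ?mulrN1 ?oppr_le0.
rewrite /qrate eqxx.
have -> : - (N%:R * (lambda + lambda_s + mu)) =
    \sum_(i < N) - (lambda + N%:R * lambda_s * tie x i) + \sum_(i < N) - mu.
  rewrite !sumrN big_split/= -mulr_sumr tie1 !sumr_const card_ord.
  by rewrite -(mulr_natl lambda) -(mulr_natl mu); ring.
apply: lerD; apply: ler_sum => i _.
  by apply: term; rewrite addr_ge0 ?mulr_ge0.
case: (0 < x i)%N; rewrite ?mulr1 ?mulr0 ?mul0r ?oppr_le0//.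
exact: term.
Qed.

End Generator.

End Occupancy.

(** * The Lyapunov function and its drift *)

Section LyapunovDrift.
Context {R : realType}.
Variables (lambda lambda_s mu : R).
Hypotheses (lambda_gt0 : 0 < lambda) (lambda_s_gt0 : 0 < lambda_s)
  (mu_gt0 : 0 < mu) (stable : lambda + lambda_s < mu).

Local Notation p := (limit_profile lambda lambda_s mu).
Local Notation c := (p 0%N).
Local Notation rho := ((lambda + lambda_s) / mu).
Local Notation sigma := (lambda / mu).

(** In equilibrium the flow of arrivals from level k to level k + 1, shared stream
    included, balances the flow of departures; shared customers enter at level
    0 only. *)
Lemma limit_profile_balance k :
  lambda * p k + (k == 0%N)%:R * lambda_s = mu * p k.+1.
Proof.
have mu0 : mu != 0 by rewrite gt_eqF.
by case: k => [|k] /=; rewrite ?exprS ?expr0 ?mul1r ?mul0r; field.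
Qed.

Lemma sum_limit_profile K : \sum_(k < K.+1) p k = 1 - rho * sigma ^+ K.
Proof.
elim: K => [|K IHK]; first by rewrite big_ord1 expr0 mulr1.
by rewrite big_ord_recr IHK /= exprS; ring.
Qed.

Lemma rho_itv : 0 <= rho <= 1.
Proof.
have := lambda_gt0; have := lambda_s_gt0; have := stable => *.
apply/andP; split; first by rewrite divr_ge0 ?addr_ge0// ltW.
by rewrite ler_pdivrMr// mul1r ltW.
Qed.

Lemma sigma_itv : 0 <= sigma <= 1.
Proof.
have := lambda_s_gt0; have := stable => *.
apply/andP; split; first by rewrite divr_ge0// ltW.
by rewrite ler_pdivrMr// mul1r; lra.
Qed.

Lemma limit_profile0_gt0 : 0 < c.
Proof. by rewrite /= subr_gt0 ltr_pdivrMr ?mul1r. Qed.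

Lemma limit_profile0_le1 : c <= 1.
Proof. by rewrite /= gerBl; case/andP: rho_itv. Qed.

Lemma limit_profile_ge0 k : 0 <= p k.
Proof.
case: k => [|k]; first exact/ltW/limit_profile0_gt0.
have /andP[r0 _] := rho_itv; have /andP[s0 s1] := sigma_itv.
by apply: mulr_ge0; [rewrite mulr_ge0 ?subr_ge0|exact: exprn_ge0].
Qed.

Lemma sum_limit_profile_le1 K : \sum_(k < K) p k <= 1.
Proof.
case: K => [|K]; first by rewrite big_ord0.
rewrite sum_limit_profile gerBl.
have /andP[r0 _] := rho_itv; have /andP[s0 s1] := sigma_itv.
by apply: mulr_ge0 => //; exact: exprn_ge0.
Qed.

Lemma limit_profile_cube : cube R p.
Proof.
move=> k; rewrite limit_profile_ge0/=.
apply: le_trans (sum_limit_profile_le1 k.+1).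
by rewrite big_ord_recr/= lerDr sumr_ge0// => j _; exact: limit_profile_ge0.
Qed.

Definition excess (u : seqspace R) k := \sum_(j < k) p j - \sum_(j < k) u j.

Definition lyapunov K (u : seqspace R) :=
  \sum_(k < K) clip_energy c (excess u k.+1).

Definition dissipation K (u : seqspace R) :=
  \sum_(k < K) (clip c (excess u k) - clip c (excess u k.+1)) ^+ 2.

Lemma excess0 u : excess u 0 = 0.
Proof. by rewrite /excess !big_ord0 subrr. Qed.

Lemma excessB u k : excess u k - excess u k.+1 = u k - p k.
Proof. by rewrite /excess !big_ord_recr/=; ring. Qed.

Lemma lyapunov_ge0 K u : 0 <= lyapunov K u.
Proof.
by apply: sumr_ge0 => k _; apply: clip_energy_ge0; exact/ltW/limit_profile0_gt0.
Qed.

Lemma dissipation_ge0 K u : 0 <= dissipation K u.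
Proof. by apply: sumr_ge0 => k _; exact: sqr_ge0. Qed.

Lemma dissipation_le J K u : (J <= K)%N -> dissipation J u <= dissipation K u.
Proof.
move=> JK; rewrite /dissipation (big_ord_widen K (fun k =>
  (clip c (excess u k) - clip c (excess u k.+1)) ^+ 2)) // big_mkcond/=.
by apply: ler_sum => k _; case: ifP => // _; exact: sqr_ge0.
Qed.

(** The excess vanishes at level 0, so a telescoping sum of small differences
    stays small. *)
Lemma clip_excess_le u K (e : R) : 0 <= e -> dissipation K u <= e ^+ 2 ->
  forall j, (j <= K)%N -> `|clip c (excess u j)| <= j%:R * e.
Proof.
move=> e0 dis; elim=> [|j IHj] jK.
  rewrite excess0 mul0r /clip min_l ?normr0//.
  exact/ltW/limit_profile0_gt0.
have step : `|clip c (excess u j) - clip c (excess u j.+1)| <= e.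
  rewrite -(@ler_pXn2r _ 2)// ?nnegrE// real_normK ?num_real//.
  apply: le_trans dis.
  rewrite /dissipation (bigD1 (Ordinal jK))//= lerDl.
  by apply: sumr_ge0 => k _; exact: sqr_ge0.
have := IHj (ltnW jK); rewrite -natr1 mulrDl mul1r.
move: step; rewrite !ler_norml => /andP[? ?] /andP[? ?].
by apply/andP; split; lra.
Qed.

Section FiniteModel.
Context {N : nat} (tie : config N -> 'I_N -> R).
Hypotheses (N_gt0 : (0 < N)%N) (tieP : tie_rule tie).
Implicit Types (x : config N) (i : 'I_N).
Local Notation q := (qrate lambda lambda_s mu tie).

Local Notation dev x := (excess (occupancy R x)).

Let c_ge0 : 0 <= c.
Proof. exact/ltW/limit_profile0_gt0. Qed.

Lemma excess_norm_le1 x k : `|excess (occupancy R x) k| <= 1.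
Proof.
have := @sum_occupancy_le1 R _ x k N_gt0; have := sum_limit_profile_le1 k.
have : 0 <= \sum_(j < k) p j by apply: sumr_ge0 => j _; exact: limit_profile_ge0.
have : 0 <= \sum_(j < k) occupancy R x j.
  by apply: sumr_ge0 => j _; exact: occupancy_ge0.
by rewrite /excess ler_norml => *; apply/andP; split; lra.
Qed.

Lemma lyapunov_le K x : lyapunov K (occupancy R x) <= K%:R.
Proof.
rewrite -[leRHS]mulr1 mulr_natl -[X in _ *+ X]card_ord -sumr_const.
apply: ler_sum => k _.
apply: le_trans (clip_energy_le _ _ (ltW limit_profile0_gt0)) _.
have : excess (occupancy R x) k.+1 ^+ 2 <= 1.
  by rewrite -real_normK ?num_real// expr_le1// excess_norm_le1.
lra.
Qed.

Lemma lyapunov_enter K x i :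
  lyapunov K (occupancy R (enter x i)) - lyapunov K (occupancy R x)
  <= (x i < K)%N%:R * clip c (excess (occupancy R x) (x i).+1) / N%:R
     + (N%:R ^+ 2)^-1 / 2.
Proof.
have /(clip_energy_sum_perturb c _ _ _ _ K) : forall k,
    excess (occupancy R (enter x i)) k
    = excess (occupancy R x) k + (k == (x i).+1)%:R * N%:R^-1.
  by move=> k; rewrite /excess sum_occupancy_enter; ring.
by rewrite exprVn mulrA.
Qed.

Lemma lyapunov_leave K x i : (0 < x i)%N ->
  lyapunov K (occupancy R (leave x i)) - lyapunov K (occupancy R x)
  <= - ((x i <= K)%N%:R * clip c (excess (occupancy R x) (x i)) / N%:R)
     + (N%:R ^+ 2)^-1 / 2.
Proof.
move=> xi0.
have /(clip_energy_sum_perturb c _ _ _ _ K) : forall k,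
    excess (occupancy R (leave x i)) k
    = excess (occupancy R x) k + (k == x i)%:R * - N%:R^-1.
  by move=> k; rewrite /excess sum_occupancy_leave//; ring.
by rewrite xi0 sqrrN exprVn mulrN mulrN mulrA.
Qed.

(** The point of the clipping: if the shortest queue is not empty, then no queue
    is, the excess at level 1 is c, and [clip] is maximal there. *)
Lemma shortest_clip K x i : (0 < K)%N -> shortest x i ->
  (x i < K)%N%:R * clip c (excess (occupancy R x) (x i).+1)
  <= clip c (excess (occupancy R x) 1).
Proof.
move=> K0 /forallP xmin; have [xi0|xi0] := posnP (x i).
  by rewrite xi0 K0 mul1r.
have -> : excess (occupancy R x) 1 = c.
  rewrite /excess !big_ord1 occupancy_eq0 ?subr0// => j.
  by rewrite -lt0n (leq_trans xi0).
rewrite [leRHS](_ : _ = c); last by rewrite /clip minxx.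
have c0 := ltW limit_profile0_gt0.
case: (x i < K)%N; rewrite ?mul1r ?mul0r//; exact: clip_le.
Qed.

(** Above all the queues the excess is minus the geometric tail of the profile,
    where the energy is quadratic. The two terms are then proportional to the
    square of that tail, with coefficients (mu - lambda) / 2 and
    - (mu - lambda). *)
Lemma boundary_term_le0 K x : (0 < K)%N -> (forall i, x i < K)%N ->
  (mu - lambda) * clip_energy c (dev x K)
  - mu * ((dev x K - dev x K.+1) * clip c (dev x K)) <= 0.
Proof.
case: K => [|K _ xK]; first by rewrite ltnn.
pose d := dev x.
have ocK : occupancy R x K.+1 = 0.
  by apply: occupancy_eq0 => i; rewrite ltn_eqF.
have dK : d K.+1 = - (rho * sigma ^+ K).
  rewrite /d /excess sum_limit_profile// sum_occupancy_eq1//; lra.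
have /andP[r0 _] := rho_itv.
have /andP[s0 _] := sigma_itv.
have tail0 : 0 <= rho * sigma ^+ K by rewrite mulr_ge0// exprn_ge0.
have clipK : clip c (d K.+1) = d K.+1.
  by rewrite /clip min_l// dK (le_trans _ c_ge0)// oppr_le0.
rewrite excessB ocK -/d /clip_energy clipK dK.
rewrite [leLHS](_ : _ = - ((mu - lambda) / 2 * (rho * sigma ^+ K) ^+ 2)); last first.
  by rewrite /=; field; rewrite gt_eqF.
rewrite oppr_le0 mulr_ge0 ?sqr_ge0// divr_ge0//.
have := stable; have := lambda_s_gt0; lra.
Qed.

Lemma boundary_term_le K x : (0 < K)%N ->
  (mu - lambda) * clip_energy c (dev x K)
  - mu * ((dev x K - dev x K.+1) * clip c (dev x K))
  <= 2 * mu * (~~ [forall i, x i < K]%N)%:R.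
Proof.
move=> K0; pose d := dev x; case: (boolP [forall i, x i < K]%N) => [/forallP xK|_].
  by rewrite mulr0; exact: boundary_term_le0.
have d1 k : `|d k| <= 1 by exact: excess_norm_le1.
have mulam : 0 <= mu - lambda <= mu.
  by apply/andP; split; have := stable; have := lambda_s_gt0; have := lambda_gt0; lra.
have Ele : clip_energy c (d K) <= 1 / 2.
  apply: le_trans (clip_energy_le _ _ c_ge0) _.
  rewrite ler_pM2r// -real_normK ?num_real// expr_le1//.
have E0 : 0 <= clip_energy c (d K) by exact: clip_energy_ge0.
have eK : `|d K - d K.+1| <= 1.
  rewrite excessB ler_norml.
  have /andP[? ?] := @occupancy_cube R _ x N_gt0 K.
  by have /andP[? ?] := limit_profile_cube K; apply/andP; split; lra.
have clipK : `|clip c (d K)| <= 1 by apply: le_trans (clip_norm_le _ _ c_ge0) _.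
have : `|(d K - d K.+1) * clip c (d K)| <= 1.
  by rewrite normrM mulr_ile1.
rewrite ler_norml => /andP[prod_ge _].
have : (mu - lambda) * clip_energy c (d K) <= mu * (1 / 2).
  by case/andP: mulam => ? ?; rewrite ler_pM.
have : mu * -1 <= mu * ((d K - d K.+1) * clip c (d K)).
  by rewrite ler_pM2l.
rewrite -/d (_ : (~~ false)%:R = 1 :> R)// mulr1; have := mu_gt0; lra.
Qed.

(** Summed form of the balance equations: the profile is an equilibrium of the
    drift, so only deviations from it contribute. *)
Lemma profile_flow K (a : nat -> R) : (0 < K)%N ->
  lambda * (\sum_(k < K) p k * a k) + lambda_s * a 0%N
  = mu * (\sum_(k < K) p k.+1 * a k).
Proof.
case: K => // K _; rewrite !mulr_sumr big_ord_recl [in RHS]big_ord_recl.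
have bal := limit_profile_balance.
rewrite addrAC; congr (_ + _).
  transitivity ((lambda * p 0%N + (0 == 0)%N%:R * lambda_s) * a 0%N).
    by rewrite (_ : (0 == 0)%N%:R = 1 :> R)//; ring.
  by rewrite bal mulrA.
apply: eq_bigr => k _.
transitivity ((lambda * p k.+1 + (k.+1 == 0)%N%:R * lambda_s) * a k.+1).
  by rewrite (_ : (k.+1 == 0)%N%:R = 0 :> R)// mul0r addr0 mulrA.
by rewrite bal mulrA.
Qed.

Lemma occupancy_drift_le K x : (0 < K)%N ->
  lambda * (\sum_(k < K) occupancy R x k * clip c (dev x k.+1))
  + lambda_s * clip c (dev x 1%N)
  - mu * (\sum_(k < K) occupancy R x k.+1 * clip c (dev x k.+1))
  <= - lambda * dissipation K (occupancy R x)
     + 2 * mu * (~~ [forall i, x i < K]%N)%:R.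
Proof.
move=> K0; pose d := dev x.
have lamu : 0 <= lambda <= mu.
  by apply/andP; split; have := stable; have := lambda_s_gt0; have := lambda_gt0; lra.
have := clip_energy_drift c lambda mu d K lamu (excess0 _) c_ge0.
have := boundary_term_le K x K0; rewrite -/d /=.
have flow := profile_flow K (fun k => clip c (d k.+1)) K0.
have -> : \sum_(k < K) (d k - d k.+1) * clip c (d k.+1)
   = \sum_(k < K) occupancy R x k * clip c (d k.+1)
     - \sum_(k < K) p k * clip c (d k.+1).
  by rewrite -sumrB; apply: eq_bigr => k _; rewrite excessB mulrBl.
have -> : \sum_(k < K) (d k.+1 - d k.+2) * clip c (d k.+1)
   = \sum_(k < K) occupancy R x k.+1 * clip c (d k.+1)
     - \sum_(k < K) p k.+1 * clip c (d k.+1).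
  by rewrite -sumrB; apply: eq_bigr => k _; rewrite excessB mulrBl.
move: flow; rewrite /dissipation -/d; lra.
Qed.

(** The increments are expanded to second order: the first-order part is the
    drift of the occupancy, with the shared stream sent to level 1 thanks to
    [shortest_clip], and the second-order part is at most 1 / (2 N ^ 2) per
    jump. *)
Lemma generator_lyapunov_le K x : (0 < K)%N ->
  \sum_(y <- neighbours x) q x y * lyapunov K (occupancy R y)
  <= - lambda * dissipation K (occupancy R x)
     + 2 * mu * (~~ [forall i, x i < K]%N)%:R
     + (lambda + lambda_s + mu) / 2 / N%:R.
Proof.
move=> K0; pose d := dev x; pose r : R := (N%:R ^+ 2)^-1 / 2.
have [tie0 tie_shortest tie1] := tieP x.
have Nr : N%:R != 0 :> R by rewrite pnatr_eq0 -lt0n.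
rewrite (sum_qrate _ _ _ _ _ (fun y => lyapunov K (occupancy R y))).
have arrivals : \sum_(i < N) (lambda + N%:R * lambda_s * tie x i)
    * (lyapunov K (occupancy R (enter x i)) - lyapunov K (occupancy R x))
  <= lambda * (\sum_(k < K) occupancy R x k * clip c (d k.+1))
     + lambda_s * clip c (d 1%N) + (lambda + lambda_s) * (N%:R * r).
  apply: (@le_trans _ _ (\sum_(i < N) (lambda + N%:R * lambda_s * tie x i)
    * ((x i < K)%N%:R * clip c (d (x i).+1) / N%:R + r))).
    apply: ler_sum => i _; apply: ler_wpM2l.
      by rewrite addr_ge0 ?mulr_ge0// ltW.
    exact: lyapunov_enter.
  rewrite (sum_occupancy x K (fun k => clip c (d k.+1))).
  have joins : \sum_(i < N) tie x i * ((x i < K)%N%:R * clip c (d (x i).+1))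
      <= clip c (d 1%N).
    rewrite -[leRHS]mul1r -[X in _ <= X * _]tie1 mulr_suml; apply: ler_sum => i _.
    have [sx|nsx] := boolP (shortest x i).
      by apply: ler_wpM2l => //; exact: shortest_clip.
    by rewrite tie_shortest// !mul0r.
  have := ler_wpM2l (ltW lambda_s_gt0) joins.
  rewrite [X in _ -> X <= _](_ : _ = lambda *
      ((\sum_(i < N) (x i < K)%N%:R * clip c (d (x i).+1)) / N%:R)
    + lambda_s * (\sum_(i < N) tie x i * ((x i < K)%N%:R * clip c (d (x i).+1)))
    + (lambda + lambda_s) * (N%:R * r)); first lra.
  transitivity (\sum_(i < N)
    (lambda * ((x i < K)%N%:R * clip c (d (x i).+1) / N%:R)
     + lambda_s * (tie x i * ((x i < K)%N%:R * clip c (d (x i).+1)))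
     + (lambda * r + N%:R * lambda_s * r * tie x i))).
    by apply: eq_bigr => i _; field.
  rewrite !big_split/= -!mulr_sumr tie1 sumr_const card_ord -mulr_suml.
  by rewrite -(mulr_natl 2^-1) /r; ring.
have departures : \sum_(i < N) mu * (0 < x i)%N%:R
    * (lyapunov K (occupancy R (leave x i)) - lyapunov K (occupancy R x))
  <= - (mu * (\sum_(k < K) occupancy R x k.+1 * clip c (d k.+1))) + mu * (N%:R * r).
  have -> : \sum_(k < K) occupancy R x k.+1 * clip c (d k.+1)
     = (\sum_(i < N) (x i < K.+1)%N%:R * ((0 < x i)%N%:R * clip c (d (x i)))) / N%:R.
    rewrite -(sum_occupancy x K.+1 (fun k => (0 < k)%N%:R * clip c (d k))).
    rewrite big_ord_recl /= mul0r mulr0 add0r; apply: eq_bigr => k _.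
    by rewrite mul1r.
  have -> : mu * (N%:R * r) = \sum_(i < N) mu * r.
    by rewrite sumr_const card_ord -(mulr_natl (mu * r)); ring.
  rewrite mulr_suml mulr_sumr -[X in _ <= X + _]sumrN -big_split/=; apply: ler_sum => i _.
  have r0 : 0 <= mu * r by rewrite mulr_ge0 ?divr_ge0 ?invr_ge0 ?sqr_ge0// ltW.
  have [xi0|xi0] := posnP (x i).
    by rewrite xi0 /= !(mul0r, mulr0) oppr0 add0r.
  have := lyapunov_leave K x i xi0.
  move=> /(ler_wpM2l (ltW mu_gt0)).
  rewrite ltnS (_ : true%:R = 1 :> R)// mulr1 mul1r -/r -/d; lra.
have := occupancy_drift_le K x K0.
rewrite -/d.
have -> : (lambda + lambda_s + mu) / 2 / N%:R = (lambda + lambda_s + mu) * (N%:R * r).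
  by rewrite /r; field.
lra.
Qed.

(** * Concentration of the stationary law *)

(** The deviation at k is the difference of two excesses, at k and k + 1, and
    c times either of them is at most k + 1 times the square root of the
    dissipation. *)
Lemma dissipation_far (x : config N) k (e : R) : 0 < e ->
  e <= `|occupancy R x k - p k| ->
  (e * c / (2 * k.+1%:R)) ^+ 2 <= dissipation k.+1 (occupancy R x).
Proof.
move=> e0; apply: contraTT; rewrite -!ltNge => dis.
have c0 : 0 < c by apply: limit_profile0_gt0.
have c1 : c <= 1 by apply: limit_profile0_le1.
have k0 : 0 < k.+1%:R :> R by rewrite ltr0n.
pose t := e * c / (2 * k.+1%:R).
have t0 : 0 < t by rewrite !divr_gt0 ?mulr_gt0.
have small j : (j <= k.+1)%N -> c * `|excess (occupancy R x) j| <= j%:R * t.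
  move=> jk; apply: le_trans (clip_excess_le _ _ _ (ltW t0) (ltW dis) _ jk).
  by apply: clip_norm_ge; [rewrite ltW|exact: excess_norm_le1].
have dk := small k (leqnSn k); have dk1 := small k.+1 (leqnn _).
have tri := ler_wpM2l (ltW c0)
  (ler_normB (excess (occupancy R x) k) (excess (occupancy R x) k.+1)).
have ce : c * e = k.+1%:R * t + k.+1%:R * t by rewrite /t; field; rewrite gt_eqF.
have kt : k%:R * t = k.+1%:R * t - t by rewrite -(natr1 k); ring.
rewrite -excessB -(ltr_pM2l c0); lra.
Qed.

(** A finite set Z1 carrying almost all the mass is chosen first, then a level K
    above all the queues in Z1, so that the boundary term of the drift only sees
    the small remaining mass. A second set Z2 absorbs the defect in
    [stationary_generator_ge], which grows with K. *)
Lemma stationary_dissipation_le (P : R -> config N -> config N -> R)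
    (nu : config N -> R) J (Z : {fset config N}) :
  transition_function q P -> prob_mass nu ->
  (forall (t : R) (A : set (borel (seqspace R))), 0 <= t -> measurable A ->
     occupancy_law (law_at P nu t) A = occupancy_law (fun x => (nu x)%:E) A) ->
  lambda * (\sum_(x <- Z) nu x * dissipation J (occupancy R x))
  <= (lambda + lambda_s + mu) / 2 / N%:R.
Proof.
move=> PP nuP stat; have nu0 := nuP.1.
pose C := (lambda + lambda_s + mu) / 2 / N%:R; rewrite -/C.
have C0 : 0 <= C.
  by rewrite !divr_ge0// addr_ge0 ?addr_ge0// ltW.
apply/ler_addgt0Pr => e e0.
have d0 : 0 < e / (4 * mu) by rewrite divr_gt0 ?mulr_gt0.
have [Z1 [ZZ1 nuZ1]] := prob_mass_exhaust _ Z _ nuP d0.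
pose K := (maxn J (\max_(x <- Z1) \max_(i < N) x i)%N).+1.
have JK : (J <= K)%N by rewrite leqW// leq_maxl.
have Z1K x : x \in Z1 -> [forall i, x i < K]%N.
  move=> xZ1; apply/forallP => i; rewrite ltnS.
  apply: leq_trans (leq_maxr _ _).
  apply: leq_trans (leq_bigmax_seq _ xZ1 isT).
  exact: (leq_bigmax i).
pose Q := N%:R * (lambda + lambda_s + mu).
have Q0 : 0 <= Q by rewrite mulr_ge0// !addr_ge0// ltW.
have KQ0 : 0 <= K%:R * Q by rewrite mulr_ge0.
have d'0 : 0 < e / 2 / (K%:R * Q + 1) by rewrite !divr_gt0// ltr_wpDl.
have [Z2 [Z12 nuZ2]] := prob_mass_exhaust _ Z1 _ nuP d'0.
have gen_ge := stationary_generator_ge _ _ PP neighbours K%:R Q nu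
  (fun x => lyapunov K (occupancy R x)) Z2.
have : - (K%:R * Q) * (1 - \sum_(z <- Z2) nu z) <=
    \sum_(x <- Z2) nu x * (- lambda * dissipation K (occupancy R x)
      + 2 * mu * (~~ [forall i, x i < K]%N)%:R + C).
  apply: le_trans (gen_ge _ _ _ _ nuP _) _.
  - by move=> z; rewrite in_fset inE eqxx.
  - exact: sum_qrate0.
  - by move=> z; apply: qrate_diag_ge => //; exact: ltW.
  - by move=> x; rewrite lyapunov_ge0//= lyapunov_le.
  - by apply: (stationary_occupancy_expect N _ P nu (lyapunov K) PP nuP stat);
      exact: lyapunov_ge0.
  - by apply: ler_sum => x _; apply: ler_wpM2l => //; exact: generator_lyapunov_le.
rewrite sum_affine.
have bad : \sum_(x <- Z2) nu x * (~~ [forall i, x i < K]%N)%:R <= e / (4 * mu).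
  apply: le_trans nuZ1; rewrite lerBrDl.
  apply: le_trans (sum_prob_mass_le1 _ Z2 nuP).
  rewrite (sum_fset_sub Z1 Z2)// -big_split; apply: ler_sum => x _ /=.
  have [xZ1|_] := boolP (x \in Z1); first by rewrite Z1K// mulr0 addr0.
  by rewrite add0r ler_piMr// lern1 leq_b1.
have : C * \sum_(x <- Z2) nu x <= C by rewrite ler_piMr// sum_prob_mass_le1.
have : lambda * (\sum_(x <- Z) nu x * dissipation J (occupancy R x))
    <= lambda * \sum_(x <- Z2) nu x * dissipation K (occupancy R x).
  rewrite ler_pM2l//.
  apply: (@le_trans _ _ (\sum_(x <- Z) nu x * dissipation K (occupancy R x))).
    by apply: ler_sum => x _; apply: ler_wpM2l => //; exact: dissipation_le.
  apply: ler_sum_fset; first exact: fsubset_trans Z12.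
  by move=> x; rewrite mulr_ge0// dissipation_ge0.
have : 2 * mu * (\sum_(x <- Z2) nu x * (~~ [forall i, x i < K]%N)%:R) <= e / 2.
  apply: le_trans (ler_wpM2l _ bad) _; first by rewrite mulr_ge0// ltW.
  rewrite le_eqVlt; apply/orP; left; apply/eqP; field; rewrite gt_eqF//.
have : K%:R * Q * (1 - \sum_(z <- Z2) nu z) <= e / 2.
  apply: le_trans (ler_wpM2l KQ0 nuZ2) _.
  rewrite mulrCA ler_piMr ?divr_ge0//; first exact: ltW.
  by rewrite ler_pdivrMr ?ltr_wpDl// mul1r lerDl.
lra.
Qed.

(** Markov inequality for the dissipation, which is bounded below where the
    coordinate k is far from its limit. *)
Lemma stationary_occupancy_far_le (P : R -> config N -> config N -> R)
    (Pi : probability (borel (seqspace R)) R) k (e : R) :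
  transition_function q P ->
  stationary_occupancy P Pi -> 0 < e ->
  (Pi (coord_far k (p k) e)
   <= ((lambda + lambda_s + mu) / 2 / N%:R
       / (lambda * (e * c / (2 * k.+1%:R)) ^+ 2))%:E)%E.
Proof.
move=> PP [nu [nuP Pinu Pistat]] e0.
have c0 : 0 < c by apply: limit_profile0_gt0.
set h := (e * c / _) ^+ 2.
have h0 : 0 < h by rewrite exprn_gt0// divr_gt0 ?mulr_gt0// ltr0n.
rewrite Pinu; last exact: coord_far_measurable.
apply: ge_ereal_sup => _ [X [finX XA] <-].
rewrite fsbig_finite//= sumEFin lee_fin ler_pdivlMr ?mulr_gt0//.
rewrite [leLHS]mulrC -[leLHS]mulrA.
have stat t A t0 mA := etrans (Pistat t A t0 mA) (Pinu A mA).
have := stationary_dissipation_le P nu k.+1 (fset_set X) PP nuP stat.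
apply: le_trans; rewrite ler_pM2l// mulr_sumr big_seq [leRHS]big_seq.
apply: ler_sum => x; rewrite in_fset_set// inE => /XA xfar.
rewrite mulrC ler_wpM2l//; first exact: nuP.1.
exact: dissipation_far.
Qed.

End FiniteModel.

End LyapunovDrift.

(** * The limit theorem *)

Theorem theorem4p2 (R : realType) (lambda lambda_s mu : R)
    (tie : forall N : nat, config N -> 'I_N -> R)
    (P : forall N : nat, R -> config N -> config N -> R)
    (Pi : nat -> probability (borel (seqspace R)) R)
    (lambda_gt0 : 0 < lambda) (lambda_s_gt0 : 0 < lambda_s) (mu_gt0 : 0 < mu)
    (stable : lambda + lambda_s < mu)
    (tieP : forall N : nat, (0 < N)%N -> tie_rule (tie N))
    (PP : forall N : nat, (0 < N)%N ->
       transition_function (qrate lambda lambda_s mu (tie N)) (P N))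
    (PiP : forall N : nat, (0 < N)%N -> stationary_occupancy (P N) (Pi N)) :
  weak_cvg_on (cube R) (fun N : nat => Pi N)
    (dirac (limit_profile lambda lambda_s mu : borel (seqspace R))).
Proof.
apply: weak_cvg_on_dirac.
- exact: cube_measurable.
- exact: limit_profile_cube.
- near=> N; have N0 : (0 < N)%N by near: N; exact: nbhs_infty_gt.
  have [nu [[nu0 nu1] Pinu _]] := PiP N N0.
  rewrite Pinu; last exact: cube_measurable.
  rewrite /occupancy_law -nu1; congr esum; apply/seteqP; split => // x _ /=.
  exact: occupancy_cube.
apply: seqspace_concentrate => k e d e0 d0.
have c0 : 0 < limit_profile lambda lambda_s mu 0 by exact: limit_profile0_gt0.
set h := lambda * (e * limit_profile lambda lambda_s mu 0 / (2 * k.+1%:R)) ^+ 2.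
have h0 : 0 < h by rewrite mulr_gt0// exprn_gt0// divr_gt0 ?mulr_gt0// ltr0n.
near=> N; have N0 : (0 < N)%N by near: N; exact: nbhs_infty_gt.
apply: le_trans (stationary_occupancy_far_le _ _ _ lambda_gt0 lambda_s_gt0 mu_gt0
  stable (tie N) N0 (tieP N N0) (P N) (Pi N) k e (PP N N0) (PiP N N0) e0) _.
rewrite lee_fin -/h ler_pdivrMr// ler_pdivrMr ?ltr0n//.
rewrite [leRHS]mulrC -ler_pdivrMr ?mulr_gt0//.
near: N; exact: nbhs_infty_ger.
Unshelve. all: by end_near.
Qed.
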